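(* Let $X_0$ be a two-level regular $N_0\times m_0$ design, let $t\ge 0$ be an integer, and let $X$ be the regular $N\times m$ design obtained by repeatedly doubling $X_0$ $t$ times, where $N=2^tN_0$ and $m=2^tm_0$. Let $D$ and $\overline{D}$ be a pair of complementary projection designs of $X$ with $n$ and $u$ columns respectively, $n+u=m$. Then for every integer $k>0$, $$\sum_{i=0}^{k} Q_k(i;n)A_i(D)=\sum_{i=0}^{k}\left[\sum_{j=i}^{k}\binom{k}{j}\left(\frac{m}{2}\right)^{k-j}(-1)^jQ_j(i;u)\right]A_i(\overline{D})+\frac{\Delta_k(D,\overline{D})}{N},$$ where $A_0(D)=A_0(\overline{D})=1$, $A_i(D)=0$ for $i>n$ and $A_i(\overline{D})=0$ for $i>u$.
   Context: Two-level regular design: a matrix with entries $0,1$ having $N=2^k$ rows (runs) and $n$ columns (factors) whose rows, up to order, are $(\langle a_1,x\rangle,\dots,\langle a_n,x\rangle)$, $x\in\mathbb{F}_2^k$, for some $a_1,\dots,a_n\in\mathbb{F}_2^k$ (so the rows run through a linear subspace of $\mathbb{F}_2^n$, each element equally often). A defining word of length $i\ge1$ is a set of $i$ columns whose sum is the zero vector mod 2. $A_i(D)$ is the number of defining words of length $i$ of $D$. Doubling: the double of a $0/1$ matrix $Y$ is $\begin{pmatrix} Y & Y \\ Y & Y+1 \end{pmatrix}$ (mod 2). After doubling $X_0$ $t$ times, each column of $X_0$ generates $2^t$ columns of $X$ (each doubling replaces a column $c$ by the two columns $\binom{c}{c}$ and $\binom{c}{c+1}$), and the first $N_0$ rows of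 $X$ are the rows of $X_0$ repeated $2^t$ times side by side. Complementary projection designs: $D$ and $\overline{D}$ are the submatrices of $X$ (all $N$ rows retained, in the row order of $X$) formed by a subset of $n$ columns and by the complementary subset of $u=m-n$ columns. $w_i(D)$ is the Hamming weight (number of ones) of the $i$th row of $D$, and $$\Delta_k(D,\overline{D})=\sum_{i=1}^{N_0}\left[w_i(D)^k-\left(m/2-w_i(\overline{D})\right)^k\right].$$ $Q_k(i;n)=(-1)^i\sum_{j=0}^{k}j!\,S(k,j)\,2^{-j}\binom{n-i}{j-i}$, where $S(k,j)=\frac{1}{j!}\sum_{i=0}^{j}(-1)^{j-i}\binom{j}{i}i^k$ is the Stirling number of the second kind (with $0^0=1$), and $\binom{n-i}{j-i}=0$ for $j<i$. *)

(* Defs.v *)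
From mathcomp Require Import all_boot all_order all_algebra.

Set Implicit Arguments.
Unset Strict Implicit.
Unset Printing Implicit Defensive.

Import GRing.Theory.
Local Open Scope ring_scope.

Definition regular_design (N n : nat) (X : 'M['F_2]_(N, n)) : Prop :=
  exists k : nat, N = (2 ^ k)%N /\
  exists (a : 'I_n -> 'rV['F_2]_k) (x : 'I_N -> 'rV['F_2]_k),
    bijective x /\
    forall (i : 'I_N) (j : 'I_n), X i j = \sum_(l < k) a j 0 l * x i 0 l.

(* A word is a set of column indices, so equal columns at different positions
   are distinct. *)
Definition defining_word (N n : nat) (D : 'M['F_2]_(N, n)) (W : {set 'I_n}) :
  bool := (0 < #|W|)%N && (\sum_(j in W) col j D == 0).

(* A_0 = 1 is a convention: defining words have length at least 1. *)
Definition wordcount (N n : nat) (D : 'M['F_2]_(N, n)) (i : nat) : nat :=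
  if i == 0%N then 1%N
  else #|[set W : {set 'I_n} | defining_word D W & #|W| == i]|.

Lemma wordcount_gt (N n : nat) (D : 'M['F_2]_(N, n)) (i : nat) :
  (n < i)%N -> wordcount D i = 0%N.
Proof.
case: i => // i lt_ni; apply/eqP; rewrite cards_eq0 -subset0.
apply/subsetP => W; rewrite inE => /andP[_ /eqP cW].
by have := max_card W; rewrite cW card_ord leqNgt lt_ni.
Qed.

Definition doubling (N m : nat) (Y : 'M['F_2]_(N, m)) :
    'M['F_2]_(N + N, m + m) :=
  block_mx Y Y Y (Y + const_mx 1).

Lemma doubling_dim0 (a : nat) : a = (2 ^ 0 * a)%N.
Proof. by rewrite mul1n. Qed.

Lemma doubling_dimS (t a : nat) :
  (2 ^ t * a + 2 ^ t * a = 2 ^ t.+1 * a)%N.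
Proof. by rewrite expnS -mulnA mul2n addnn. Qed.

Fixpoint iter_doubling (t N m : nat) (Y : 'M['F_2]_(N, m)) :
    'M['F_2]_(2 ^ t * N, 2 ^ t * m) :=
  match t with
  | 0 => castmx (doubling_dim0 N, doubling_dim0 m) Y
  | t'.+1 =>
      castmx (doubling_dimS t' N, doubling_dimS t' m)
             (doubling (iter_doubling t' Y))
  end.

Definition projection_design (N m : nat) (X : 'M['F_2]_(N, m))
    (S : {set 'I_m}) : 'M['F_2]_(N, #|S|) :=
  colsub (fun j : 'I_#|S| => enum_val j) X.

Definition row_weight (N n : nat) (D : 'M['F_2]_(N, n)) (i : 'I_N) : nat :=
  #|[set j : 'I_n | D i j == 1]|.

(* N0 is the number of leading rows (0-based indices i < N0) summed over. *)
Definition Delta (N0 m k N n u : nat)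
    (D : 'M['F_2]_(N, n)) (Dbar : 'M['F_2]_(N, u)) : rat :=
  \sum_(i < N | (i < N0)%N)
    ((row_weight D i)%:R ^+ k - (m%:R / 2 - (row_weight Dbar i)%:R) ^+ k).

Definition stirling2 (k j : nat) : rat :=
  (j`!)%:R^-1 *
  \sum_(0 <= i < j.+1) (-1) ^+ (j - i) * ('C(j, i))%:R * i%:R ^+ k.

(* The subtraction n - i is truncated; this only matters for i > n, where Q is
   always multiplied by a word count that vanishes (wordcount_gt). *)
Definition Q (k i n : nat) : rat :=
  (-1) ^+ i *
  \sum_(0 <= j < k.+1)
    (j`!)%:R * stirling2 k j * 2 ^- j *
    (if (i <= j)%N then 'C(n - i, j - i) else 0%N)%:R.

(* Main.v *)
(** Over the rows of a regular design, and hence of any of its doublings and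
    projections, the character attached to a set of columns sums to the number
    of rows if the set is empty or a defining word, and to 0 otherwise.
    Expanding the [k]-th power of a row weight in the characters, with
    coefficients [Q k #|W| n], therefore turns the [k]-th moment of the row
    weights into a combination of the word counts.  In a [t]-fold doubling every
    row beyond the first [N0] has weight [m / 2], so the weights of
    complementary projections add up to [m / 2] there; comparing the moments of
    [w_i(D)] and of [m / 2 - w_i(Dbar)] leaves only the first [N0] rows. *)

Require Import Defs.
From mathcomp Require Import all_boot all_order all_algebra.
From mathcomp Require Import ring lra zify.

Set Implicit Arguments.
Unset Strict Implicit.
Unset Printing Implicit Defensive.

Import Order.TTheory GRing.Theory Num.Theory.
Local Open Scope ring_scope.

(** * Surjection numbers *)

(** The number of surjections from a [k]-set onto a [j]-set, by inclusion-exclusion; keeping the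
    factor [j!] gives a division-free recurrence. *)
Definition surj_number (k j : nat) : rat :=
  \sum_(i < j.+1) (-1) ^+ (j - i) * ('C(j, i))%:R * i%:R ^+ k.

Lemma stirling2E (k j : nat) : (j`!)%:R * stirling2 k j = surj_number k j.
Proof.
rewrite /stirling2 big_mkord mulrA divff ?mul1r //.
by rewrite pnatr_eq0 -lt0n fact_gt0.
Qed.

Lemma surj_numberS0 (k : nat) : surj_number k.+1 0 = 0.
Proof. by rewrite /surj_number big_ord1 expr0n mulr0. Qed.

(** Termwise, this is the absorption identity [h] followed by Pascal's rule [hC]. *)
Lemma surj_numberSS (k j : nat) :
  surj_number k.+1 j.+1 = j.+1%:R * (surj_number k j.+1 + surj_number k j).
Proof.
rewrite /surj_number.
(* Extended by a vanishing term and with its sign shifted, the sum for [j] combines termwise with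
   the one for [j.+1]. *)
have -> : \sum_(i < j.+1) (-1) ^+ (j - i) * ('C(j, i))%:R * i%:R ^+ k =
  - \sum_(i < j.+2) (-1) ^+ (j.+1 - i) * ('C(j, i))%:R * i%:R ^+ k :> rat.
  rewrite [in RHS]big_ord_recr /= (@bin_small j j.+1) // mulr0 mul0r addr0.
  rewrite -sumrN; apply: eq_bigr => i _.
  by rewrite subSn -1?ltnS // exprS mulN1r !mulNr opprK.
rewrite -sumrB mulr_sumr; apply: eq_bigr => -[i /= _] _.
case: i => [|i]; first by rewrite !bin0 expr0n mulr0 subrr mulr0.
have h : ('C(j.+1, i.+1))%:R * i.+1%:R = j.+1%:R * ('C(j, i))%:R :> rat.
  by rewrite -!natrM mulnC -mul_bin_diag.
have hC : ('C(j.+1, i.+1))%:R = ('C(j, i.+1))%:R + ('C(j, i))%:R :> rat.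
  by rewrite binS natrD.
rewrite exprS -mulrA [X in _ * X = _]mulrA h hC.
by ring.
Qed.

Lemma surj_number_small (k j : nat) : (k < j)%N -> surj_number k j = 0.
Proof.
elim: k j => [|k IHk] [|j] // lt_kj; last first.
  by rewrite surj_numberSS !IHk ?addr0 ?mulr0 // ltnW.
rewrite /surj_number.
(* With [k = 0] the alternating sum is the expansion of [(-1 + 1) ^+ j.+1]. *)
have := exprDn (-1) 1 j.+1 : (_ : rat) = _; rewrite addNr expr0n /= => h.
rewrite [RHS]h; apply: eq_bigr => i _.
by rewrite expr0 mulr1 expr1n mulr1 mulr_natr.
Qed.

(** A map from a [k]-set to a [w]-set is a surjection onto its image. The proof is by induction on
    [k], using [w C(w, j) = j C(w, j) + (j + 1) C(w, j + 1)]. *)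
Lemma sum_bin_surj_number (k w : nat) :
  \sum_(j < k.+1) surj_number k j * ('C(w, j))%:R = w%:R ^+ k.
Proof.
elim: k => [|k IHk].
  by rewrite big_ord1 bin0 /surj_number big_ord1 !mulr1 !expr0.
rewrite big_ord_recl surj_numberS0 mul0r add0r.
transitivity (\sum_(j < k.+1) surj_number k j *
                 (j%:R * ('C(w, j))%:R + j.+1%:R * ('C(w, j.+1))%:R)).
  rewrite (eq_bigr (fun j : 'I_k.+1 =>
    surj_number k j.+1 * (j.+1%:R * ('C(w, j.+1))%:R) +
    surj_number k j * (j.+1%:R * ('C(w, j.+1))%:R))); last first.
    by move=> j _; rewrite surj_numberSS; ring.
  rewrite big_split /= [in RHS](eq_bigr _ (fun j _ => mulrDr _ _ _)).
  rewrite [in RHS]big_split /=; congr (_ + _).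
  rewrite [LHS]big_ord_recr /= surj_number_small // mul0r addr0.
  by rewrite [RHS]big_ord_recl /= mul0r mulr0 add0r.
rewrite exprS -IHk mulr_sumr; apply: eq_bigr => j _.
rewrite mulrCA; congr (_ * _); rewrite -!natrM -natrD mul_bin_left -mulnDl.
case: (leqP j w) => [le_jw|lt_wj]; first by rewrite subnKC.
by rewrite bin_small // !muln0.
Qed.

(** * Powers of a cardinality as sums of characters *)

(** Complementation turns these sets into the subsets of [~: W] of size [#|I| - j]. The count is the
    binomial factor in [Q]. *)
Lemma card_supersets (I : finType) (W : {set I}) (j : nat) :
  #|[set J : {set I} | W \subset J & #|J| == j]| =
  (if (#|W| <= j)%N then 'C(#|I| - #|W|, j - #|W|) else 0)%N.
Proof.
case: leqP => [le_Wj|lt_jW]; last first.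
  apply/eqP; rewrite cards_eq0 -subset0; apply/subsetP => J.
  rewrite !inE => /andP[/subset_leq_card le_WJ /eqP cJ].
  by rewrite leqNgt cJ lt_jW in le_WJ.
case: (leqP j #|I|) => [le_jI|lt_Ij]; last first.
  rewrite bin_small; last by have := max_card W; lia.
  apply/eqP; rewrite cards_eq0 -subset0; apply/subsetP => J.
  rewrite !inE => /andP[_ /eqP cJ].
  by have := max_card J; rewrite cJ leqNgt lt_Ij.
rewrite -(card_imset _ (@setC_inj I)).
have -> : [set ~: J | J in [set J : {set I} | W \subset J & #|J| == j]] =
          [set K : {set I} | K \subset ~: W & #|K| == (#|I| - j)%N].
  apply/setP => K; rewrite inE; apply/imsetP/andP => [[J]|[sKW /eqP cK]].
    rewrite inE => /andP[sWJ /eqP cJ] ->; rewrite setCS; split=> //.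
    by apply/eqP; have := cardsC J; lia.
  exists (~: K); rewrite ?setCK // inE subsetC sKW /=.
  apply/eqP; have := cardsC K; lia.
rewrite cards_draws; have -> : #|~: W| = (#|I| - #|W|)%N.
  by have := cardsC W; lia.
rewrite -[RHS]bin_sub; last by lia.
by congr 'C(_, _); lia.
Qed.

Lemma Q_small (k i n : nat) : (k < i)%N -> Q k i n = 0.
Proof.
move=> lt_ki; rewrite /Q big_mkord big1 ?mulr0 // => j _.
by rewrite leqNgt (leq_trans (ltn_ord j)) // mulr0.
Qed.

(** The sum expands the product over [j] in [J] of [1 + s j], where any [j] outside [T] gives a
    factor 0. *)
Lemma sum_subset_prod_pm1 (I : finType) (T J : {set I}) :
  \sum_(W : {set I} | W \subset J) \prod_(j in W) (if j \in T then 1 else -1)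
  = (if J \subset T then 2 ^+ #|J| else 0) :> rat.
Proof.
pose s j : rat := if j \in T then 1 else -1.
transitivity (\prod_j ((if j \in J then s j else 0) + 1)).
  rewrite bigA_distr [LHS]big_mkcond /=; apply: eq_bigr => W _.
  case: ifPn => [sWJ|/subsetPn[j jW jJ]]; last first.
    by rewrite (bigD1 j) //= jW (negPf jJ) mul0r.
  rewrite big_mkcond /=; apply: eq_bigr => j _; case: ifP => // jW.
  by rewrite (subsetP sWJ).
case: ifPn => [sJT|/subsetPn[j jJ jT]]; last first.
  by rewrite (bigD1 j) //= jJ /s (negPf jT) addNr mul0r.
rewrite -[RHS]prodr_const [RHS]big_mkcond /=; apply: eq_bigr => j _.
by case: ifP => [jJ|_]; rewrite ?add0r // /s (subsetP sJT).
Qed.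

(** By [sum_bin_surj_number] the power is a weighted count of the subsets [J] of [T]. By
    [sum_subset_prod_pm1] the condition [J \subset T] is [2 ^- #|J|] times a sum of sign products
    over the subsets [W] of [J]. Collecting the terms of each [W] gives [Q]. *)
Lemma sum_Q_characters (n k : nat) (T : {set 'I_n}) :
  \sum_(W : {set 'I_n}) Q k #|W| n * \prod_(j in W) (if j \in T then -1 else 1)
  = #|T|%:R ^+ k :> rat.
Proof.
(* These signs are opposite to those of the statement; the factor [(-1) ^+ #|W|] of [Q] absorbs the
   change. *)
pose s j : rat := if j \in T then 1 else -1.
transitivity (\sum_(W : {set 'I_n}) \sum_(j < k.+1) \sum_(J : {set 'I_n} |
    (W \subset J) && (#|J| == j)) surj_number k j * 2 ^- j * \prod_(i in W) s i).
  apply: eq_bigr => W _; rewrite /Q big_mkord mulrAC mulr_sumr.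
  apply: eq_bigr => j _; rewrite sumr_const stirling2E.
  have -> : #|[pred J : {set 'I_n} | W \subset J & #|J| == j]| =
            #|[set J : {set 'I_n} | W \subset J & #|J| == j]|.
    by apply: eq_card => J; rewrite inE.
  rewrite card_supersets card_ord -mulr_natr -[in LHS]prodr_const -big_split /=.
  rewrite (eq_bigr s) => [|i _]; last by rewrite /s; case: ifP; rewrite mulN1r ?opprK.
  by ring.
rewrite exchange_big -(sum_bin_surj_number k #|T|) /=; apply: eq_bigr => j _.
rewrite (exchange_big_dep (fun J : {set 'I_n} => #|J| == j)) /=; last first.
  by move=> W J _ /andP[].
rewrite -cards_draws -sumr_const mulr_sumr.
rewrite [RHS](eq_bigl (fun J : {set 'I_n} => (#|J| == j) && (J \subset T))); last first.
  by move=> J; rewrite inE andbC.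
rewrite [RHS]big_mkcondr /=; apply: eq_bigr => J /eqP cJ.
rewrite -mulr_sumr /= (eq_bigl (fun W : {set _} => W \subset J)); last first.
  by move=> W; rewrite cJ eqxx andbT.
rewrite sum_subset_prod_pm1 cJ; case: ifP => _; rewrite ?mulr0 //.
by rewrite mulr1 divfK // expf_neq0.
Qed.

(** * Character sums over the rows of a design *)

Definition sgF2 (x : 'F_2) : rat := if x == 1 then -1 else 1.

Lemma F2_cases (x : 'F_2) : x = 0 \/ x = 1.
Proof. by case: x => -[|[|//]] lt_x2; [left|right]; apply: val_inj. Qed.

Lemma sgF2D (x y : 'F_2) : sgF2 (x + y) = sgF2 x * sgF2 y.
Proof.
by case: (F2_cases x) => ->; case: (F2_cases y) => ->;
  rewrite /sgF2 /= ?mulr1 ?mulrNN ?mulr1.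
Qed.

Lemma sgF2_sum (I : finType) (W : {set I}) (F : I -> 'F_2) :
  sgF2 (\sum_(j in W) F j) = \prod_(j in W) sgF2 (F j).
Proof. exact: (big_morph sgF2 sgF2D). Qed.

(** Regularity enters only in this form, which passes to projections and doublings without
    parametrising the rows again. The vector [v] encodes a set of columns. *)
Definition balanced (N n : nat) (X : 'M['F_2]_(N, n)) : Prop :=
  forall v : 'cV['F_2]_n, X *m v = 0 \/ \sum_i sgF2 ((X *m v) i 0) = 0.

(** Selecting columns is multiplication on the right by a matrix, which can be moved onto [v]. *)
Lemma balanced_colsub (N n p : nat) (f : 'I_p -> 'I_n) (X : 'M['F_2]_(N, n)) :
  balanced X -> balanced (colsub f X).
Proof.
by move=> balX v; rewrite -[X]mulmx1 -mulmx_colsub -mulmxA; apply: balX.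
Qed.

Lemma balanced_castmx (N n N' n' : nat) (e : (N = N') * (n = n'))
    (X : 'M['F_2]_(N, n)) : balanced X -> balanced (castmx e X).
Proof. by case: e => eN en; case: _ / eN; case: _ / en. Qed.

(* Translating by a coordinate vector on which [c] does not vanish flips the
   sign of every term. *)
Lemma sum_character_eq0 (k : nat) (c : 'rV['F_2]_k) : c != 0 ->
  \sum_(x : 'rV['F_2]_k) sgF2 (\sum_(l < k) c 0 l * x 0 l) = 0.
Proof.
move=> nz_c; have [l /eqP c_l] : exists l, c 0 l == 1.
  apply/existsP; apply: contra_neqT nz_c => /existsPn h.
  by apply/rowP => l; rewrite mxE; case: (F2_cases (c 0 l)) (h l) => ->.
set s := LHS; suff : s = - s by lra.
rewrite {1}/s (reindex_inj (addIr (delta_mx 0 l))) -sumrN; apply: eq_bigr => x _.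
rewrite (eq_bigr (fun i => c 0 i * x 0 i + c 0 i * (i == l)%:R)); last first.
  by move=> i _; rewrite !mxE eqxx mulrDr.
rewrite big_split /= sgF2D [X in _ * sgF2 X](bigD1 l) //= [X in _ + X]big1 => [|i /negPf->].
  by rewrite eqxx c_l mulr1 addr0 mulrN1.
by rewrite mulr0.
Qed.

(** The entries of [X *m v] are the values of one linear form [c] at the points [x i], which run
    once through the whole space. *)
Lemma regular_design_balanced (N n : nat) (X : 'M['F_2]_(N, n)) :
  regular_design X -> balanced X.
Proof.
case=> k [_ [a [x [[y xK yK] defX]]]] v.
pose c : 'rV['F_2]_k := \sum_j v j 0 *: a j.
have defXv i : (X *m v) i 0 = \sum_(l < k) c 0 l * x i 0 l.
  rewrite mxE (eq_bigr (fun j => \sum_(l < k) v j 0 * a j 0 l * x i 0 l)).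
    rewrite exchange_big; apply: eq_bigr => l _; rewrite -mulr_suml.
    by rewrite /c summxE; congr (_ * _); apply: eq_bigr => j _; rewrite mxE.
  move=> j _; rewrite defX mulr_suml; apply: eq_bigr => l _.
  by rewrite mulrC mulrA.
have [c0|nz_c] := eqVneq c 0.
  left; apply/colP => i; rewrite defXv c0 mxE big1 // => l _.
  by rewrite mxE mul0r.
right; rewrite -[RHS](sum_character_eq0 nz_c).
rewrite [RHS](reindex x); first by apply: eq_bigr => i _; rewrite defXv.
by exists y => ? _.
Qed.

(** With [v] split into [v1] and [v2], the product is [y = X *m (v1 + v2)] above [y + b], where [b]
    sums the entries of [v2]. The character sum of [y] thus gets the factor [1 + sgF2 b], which is 0
    for [b = 1]. *)
Lemma balanced_doubling (N n : nat) (X : 'M['F_2]_(N, n)) :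
  balanced X -> balanced (doubling X).
Proof.
move=> balX v; rewrite -(vsubmxK v) /doubling mul_block_col mulmxDl.
set v1 := usubmx v; set v2 := dsubmx v.
rewrite addrA -mulmxDr; set y := X *m _; pose b := \sum_j v2 j 0.
have -> : const_mx 1 *m v2 = const_mx b :> 'cV['F_2]_N.
  by apply/colP => i; rewrite !mxE; apply: eq_bigr => j _; rewrite mxE mul1r.
have sumE : \sum_i sgF2 (col_mx y (y + const_mx b) i 0) =
    (1 + sgF2 b) * \sum_i sgF2 (y i 0).
  rewrite big_split_ord mulrDl mul1r /=; congr (_ + _).
    by apply: eq_bigr => i _; rewrite col_mxEu.
  rewrite mulr_sumr; apply: eq_bigr => i _.
  by rewrite col_mxEd !mxE sgF2D mulrC.
rewrite sumE; case: (F2_cases b) => ->; last by right; rewrite addrN mul0r.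
have [y0|s0] := balX (v1 + v2); last by right; rewrite s0 mulr0.
left; rewrite /y y0 add0r (_ : const_mx 0 = 0) ?col_mx0 //.
Qed.

Lemma balanced_iter_doubling (t N n : nat) (X : 'M['F_2]_(N, n)) :
  balanced X -> balanced (iter_doubling t X).
Proof.
move=> balX; elim: t => [|t IHt] /=; apply: balanced_castmx => //.
exact: balanced_doubling.
Qed.

(** * Moments of the row weights *)

(** The convention for length 0 fits: the empty set is the only set of size 0, and its column sum
    vanishes. *)
Lemma wordcountE (N n : nat) (D : 'M['F_2]_(N, n)) (i : nat) :
  wordcount D i =
  #|[set W : {set 'I_n} | \sum_(j in W) col j D == 0 & #|W| == i]|.
Proof.
rewrite /wordcount; case: eqP => [->|/eqP nz_i].
  rewrite -[LHS](cards1 (@set0 'I_n)); apply: eq_card => W; rewrite !inE cards_eq0.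
  by case: eqVneq => [->|]; rewrite ?big_set0 ?eqxx ?andbF.
apply: eq_card => W; rewrite !inE /defining_word.
by case: (#|W| =P i) => [->|]; rewrite ?andbF // lt0n nz_i.
Qed.

Lemma balanced_moment (N n k : nat) (D : 'M['F_2]_(N, n)) :
  balanced D ->
  \sum_(i < N) (row_weight D i)%:R ^+ k =
  N%:R * \sum_(0 <= i < k.+1) Q k i n * (wordcount D i)%:R.
Proof.
move=> balD; pose null (W : {set 'I_n}) := \sum_(j in W) col j D == 0.
have charE (W : {set 'I_n}) :
    \sum_i \prod_(j in W) sgF2 (D i j) = (null W)%:R * N%:R.
  (* For this indicator vector, [D *m v] is the sum of the columns in [W]. *)
  pose v : 'cV['F_2]_n := \col_j (j \in W)%:R.
  have Dv : D *m v = \sum_(j in W) col j D.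
    apply/colP => i; rewrite mxE summxE [RHS]big_mkcond /=.
    apply: eq_bigr => j _; rewrite !mxE.
    by case: ifP; rewrite ?mulr1 ?mulr0.
  have sgE i : \prod_(j in W) sgF2 (D i j) = sgF2 ((D *m v) i 0).
    rewrite Dv summxE -sgF2_sum; congr sgF2.
    by apply: eq_bigr => j _; rewrite mxE.
  rewrite (eq_bigr _ (fun i _ => sgE i)) /null -Dv.
  have [Dv0|nz_Dv] := eqVneq (D *m v) 0; last first.
    by case: (balD v) nz_Dv => [->|->]; rewrite ?eqxx // mul0r.
  rewrite Dv0 mul1r (eq_bigr (fun=> 1)) ?sumr_const ?card_ord // => i _.
  by rewrite mxE.
transitivity (\sum_(i < N) \sum_(W : {set 'I_n})
                Q k #|W| n * \prod_(j in W) sgF2 (D i j)).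
  apply: eq_bigr => i _; rewrite /row_weight -sum_Q_characters.
  apply: eq_bigr => W _; congr (_ * _); apply: eq_bigr => j _.
  by rewrite inE.
rewrite exchange_big /=.
rewrite (eq_bigr (fun W : {set 'I_n} => N%:R * (Q k #|W| n * (null W)%:R))).
  rewrite -mulr_sumr; congr (_ * _).
  (* The sets with zero column sum are grouped by size; those larger than [k] contribute nothing, by
     [Q_small]. *)
  rewrite big_mkord [RHS](eq_bigr (fun i : 'I_k.+1 =>
    \sum_(W : {set 'I_n} | null W && (#|W| == i)) Q k #|W| n)) => [|i _]; last first.
    rewrite (eq_bigr (fun=> Q k i n)) => [|W /andP[_ /eqP->//]].
    rewrite sumr_const wordcountE mulr_natr; congr (_ *+ _).
    by apply: eq_card => W; rewrite !inE.
  rewrite [RHS](exchange_big_dep null) /= => [|i W _ /andP[]//].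
  rewrite [RHS]big_mkcond /=; apply: eq_bigr => W _.
  case: ifP => nW; rewrite ?mulr0 // mulr1.
  have [le_Wk|lt_kW] := leqP #|W| k; last first.
    by rewrite Q_small // big1.
  rewrite (big_pred1 (Ordinal (le_Wk : #|W| < k.+1)%N)) // => i.
  by rewrite /= nW eq_sym.
by move=> W _; rewrite -mulr_sumr charE; ring.
Qed.

(** * Row weights under doubling and projection *)

Lemma row_weightE (N n : nat) (X : 'M['F_2]_(N, n)) i :
  row_weight X i = (\sum_j (X i j == 1%R))%N.
Proof.
rewrite /row_weight -sum1_card big_mkcond /=.
by apply: eq_bigr => j _; rewrite inE; case: (_ == _).
Qed.

Lemma row_weight_castmx (N n N' n' : nat) (e : (N = N') * (n = n'))
    (X : 'M['F_2]_(N, n)) i :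
  row_weight (castmx e X) i = row_weight X (cast_ord (esym e.1) i).
Proof.
by case: e => eN en; case: _ / eN i; case: _ / en => i /=; rewrite cast_ord_id.
Qed.

Lemma row_weight_doubling_top (N n : nat) (X : 'M['F_2]_(N, n)) i :
  row_weight (doubling X) (lshift N i) = (2 * row_weight X i)%N.
Proof.
rewrite !row_weightE big_split_ord mul2n -addnn /=.
by congr (_ + _)%N; apply: eq_bigr => j _; rewrite ?block_mxEul ?block_mxEur.
Qed.

(** Of an entry and its copy shifted by 1, exactly one equals 1. *)
Lemma row_weight_doubling_bottom (N n : nat) (X : 'M['F_2]_(N, n)) i :
  row_weight (doubling X) (rshift N i) = n.
Proof.
rewrite row_weightE big_split_ord /= -big_split /= -[RHS]card_ord -sum1_card.
apply: eq_bigr => j _; rewrite block_mxEdl block_mxEdr !mxE.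
by case: (F2_cases (X i j)) => ->.
Qed.

(** In the last doubling, a bottom row has ones in half of the columns, and a top row repeats twice
    a row with the same index, to which induction applies. *)
Lemma row_weight_iter_doubling (t N n : nat) (X : 'M['F_2]_(N, n))
    (i : 'I_(2 ^ t * N)) :
  (N <= i)%N -> (2 * row_weight (iter_doubling t X) i = 2 ^ t * n)%N.
Proof.
elim: t i => [|t IHt] i le_Ni.
  by have := ltn_ord i; rewrite [X in (_ < X)%N]mul1n ltnNge le_Ni.
rewrite /= row_weight_castmx /=.
case: (split_ordP (cast_ord (esym (doubling_dimS t N)) i)) => j defj;
  rewrite defj; move/(congr1 val): defj => /= val_j.
  rewrite row_weight_doubling_top IHt -?val_j //.
  by rewrite expnS -mulnA.
by rewrite row_weight_doubling_bottom expnS mulnA.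
Qed.

Lemma row_weight_projection (N n : nat) (X : 'M['F_2]_(N, n))
    (S : {set 'I_n}) i :
  row_weight (projection_design X S) i = (\sum_(j in S) (X i j == 1%R))%N.
Proof.
rewrite row_weightE [RHS]big_enum_val.
by apply: eq_bigr => j _; rewrite mxE.
Qed.

Lemma row_weight_projectionC (N n : nat) (X : 'M['F_2]_(N, n))
    (S : {set 'I_n}) i :
  (row_weight (projection_design X S) i +
   row_weight (projection_design X (~: S)) i)%N = row_weight X i.
Proof.
rewrite !row_weight_projection row_weightE [RHS](bigID (mem S)) /=.
by congr (_ + _)%N; apply: eq_bigl => j; rewrite inE.
Qed.

(** * Comparison of the complementary designs *)

(** The binomial theorem reduces this to [balanced_moment]. The [j]-th moment involves only lengths
    [i <= j], so after exchanging the sums [j] starts at [i]. *)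
Lemma balanced_moment_sub (N u k : nat) (h : rat) (E : 'M['F_2]_(N, u)) :
  balanced E ->
  \sum_(i < N) (h - (row_weight E i)%:R) ^+ k =
  N%:R * \sum_(0 <= i < k.+1)
    (\sum_(i <= j < k.+1) ('C(k, j))%:R * h ^+ (k - j) * (-1) ^+ j * Q j i u)
    * (wordcount E i)%:R.
Proof.
move=> balE; pose a j : rat := ('C(k, j))%:R * h ^+ (k - j) * (-1) ^+ j.
transitivity (\sum_(0 <= j < k.+1) a j * \sum_(i < N) (row_weight E i)%:R ^+ j).
  rewrite (eq_bigr (fun i => \sum_(0 <= j < k.+1) a j * (row_weight E i)%:R ^+ j)).
    by rewrite exchange_big; apply: eq_bigr => j _; rewrite mulr_sumr.
  move=> i _; rewrite exprDn big_mkord; apply: eq_bigr => j _.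
  by rewrite [in LHS]exprNn -[LHS]mulr_natr /a; ring.
rewrite big_mkord [X in _ = _ * X]big_mkord.
rewrite [in RHS](eq_bigr (fun i : 'I_k.+1 => \sum_(j < k.+1 | (i <= j)%N)
                    a j * (Q j i u * (wordcount E i)%:R))); last first.
  move=> i _; rewrite big_geq_mkord mulr_suml.
  by apply: eq_bigr => j _; rewrite mulrA.
rewrite [in RHS](exchange_big_dep xpredT) //= mulr_sumr.
apply: eq_bigr => j _; rewrite (balanced_moment j balE) mulrCA -mulr_sumr.
rewrite (@big_nat_widen _ _ _ 0 j.+1 k.+1) ?ltn_ord // big_mkord.
by under [in RHS]eq_bigl => i do rewrite -ltnS.
Qed.

Theorem theorem1 (N0 m0 t : nat) (X0 : 'M['F_2]_(N0, m0))
    (hX0 : regular_design X0) (S : {set 'I_(2 ^ t * m0)})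
    (k : nat) (hk : (0 < k)%N) :
  let N := (2 ^ t * N0)%N in
  let m := (2 ^ t * m0)%N in
  let X := iter_doubling t X0 in
  let n := #|S| in
  let u := #|~: S| in
  let D := projection_design X S in
  let Dbar := projection_design X (~: S) in
  \sum_(0 <= i < k.+1) Q k i n * (wordcount D i)%:R =
  \sum_(0 <= i < k.+1)
    (\sum_(i <= j < k.+1)
       ('C(k, j))%:R * (m%:R / 2) ^+ (k - j) * (-1) ^+ j * Q j i u)
    * (wordcount Dbar i)%:R
  + Delta N0 m k D Dbar / N%:R.
Proof.
move=> N m X n u D Dbar.
have balX : balanced X.
  exact/balanced_iter_doubling/regular_design_balanced.
have nz_N : N%:R != 0 :> rat.
  case: hX0 => l [defN0 _].
  by rewrite pnatr_eq0 -lt0n muln_gt0 defN0 !expn_gt0.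
have DeltaE : Delta N0 m k D Dbar = \sum_(i < N) (row_weight D i)%:R ^+ k -
    \sum_(i < N) (m%:R / 2 - (row_weight Dbar i)%:R) ^+ k.
  rewrite -sumrB [RHS](bigID (fun i : 'I_N => (i < N0)%N)) /=.
  rewrite [X in _ + X]big1 ?addr0 // => i; rewrite -leqNgt => le_N0i.
  apply/eqP; rewrite subr_eq0; apply/eqP; congr (_ ^+ _).
  have := row_weight_iter_doubling X0 le_N0i.
  rewrite -(row_weight_projectionC _ S) => /(congr1 (GRing.natmul (1 : rat))).
  rewrite natrM natrD -/D -/Dbar -/m => wE.
  by rewrite -wE; field.
(* Multiplied by [N%:R], both sums over word counts become moments, and [DeltaE] is their
   difference. *)
apply: (mulfI nz_N).
rewrite mulrDr [N%:R * (_ / _)]mulrC divfK // DeltaE.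
rewrite -balanced_moment; last exact: balanced_colsub.
rewrite -balanced_moment_sub; last exact: balanced_colsub.
by rewrite addrC subrK.
Qed.
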